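(* Let $G$ be a finite group with identity $e$, let $S\subseteq G\setminus\{e\}$ with $S=S^{-1}$, and suppose the Cayley graph $\Gamma=\mathrm{Cay}(G,S)$ is a Neumaier graph with parameters $(n,k,\lambda;a,c)$ having a regular clique $C$ with $e\in C$, $|C|=c$ and nexus $a$. Then $\Gamma$ is strongly regular if and only if all vertices in $G\setminus(S\cup\{e\})$ have the same number of neighbours in $S\setminus C$.
   Context: All graphs are finite, undirected and simple. The Cayley graph $\mathrm{Cay}(G,S)$ has vertex set $G$, with $x\sim y$ iff $xy^{-1}\in S$. A $k$-regular graph on $n$ vertices is edge-regular with parameters $(n,k,\lambda)$ if every two adjacent vertices have exactly $\lambda$ common neighbours. A clique $C$ is regular with nexus $a$ (here $a\ge 1$) if every vertex outside $C$ is adjacent to exactly $a$ vertices of $C$. A Neumaier graph is a non-complete edge-regular graph with a regular clique; its parameters $(n,k,\lambda;a,c)$ record the edge-regular parameters, the nexus $a$ and the clique size $c$. A strongly regular graph with parameters $(n,k,\lambda,\mu)$ is a $k$-regular graph on $n$ vertices in which adjacent vertices have $\lambda$ and distinct non-adjacent vertices have $\mu$ common neighbours. *)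

(* Defs.v *)
From HB Require Import structures.
From mathcomp Require Import all_boot all_fingroup.

Set Implicit Arguments.
Unset Strict Implicit.
Unset Printing Implicit Defensive.

Section Graphs.
Variable T : finType.
Implicit Types (adj : rel T) (C : {set T}) (x y : T).

Definition simple_graph adj : Prop := symmetric adj /\ irreflexive adj.

Definition neighbours adj x : {set T} := [set y | adj x y].

Definition complete_graph adj : Prop := forall x y, x != y -> adj x y.

Definition regular_graph adj (n k : nat) : Prop :=
  [/\ simple_graph adj, #|T| = n & forall x, #|neighbours adj x| = k].

Definition edge_regular adj (n k lambda : nat) : Prop :=
  regular_graph adj n k /\
  forall x y, adj x y -> #|neighbours adj x :&: neighbours adj y| = lambda.

Definition strongly_regular_with adj (n k lambda mu : nat) : Prop :=
  edge_regular adj n k lambda /\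
  forall x y, x != y -> ~~ adj x y ->
    #|neighbours adj x :&: neighbours adj y| = mu.

Definition strongly_regular adj : Prop :=
  exists n k lambda mu, strongly_regular_with adj n k lambda mu.

Definition clique adj C : Prop :=
  forall x y, x \in C -> y \in C -> x != y -> adj x y.

Definition regular_clique adj C (a : nat) : Prop :=
  [/\ clique adj C, 1 <= a &
      forall x, x \notin C -> #|neighbours adj x :&: C| = a].

Definition neumaier adj (n k lambda a c : nat) : Prop :=
  [/\ edge_regular adj n k lambda, ~ complete_graph adj &
      exists C, regular_clique adj C a /\ #|C| = c].

End Graphs.

Definition cayley (gT : finGroupType) (S : {set gT}) : rel gT :=
  fun x y => (x * y^-1)%g \in S.

(* Main.v *)
Require Import Defs.
From mathcomp Require Import all_boot all_fingroup.

(** Right translations are automorphisms of the Cayley graph, so it is strongly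
    regular as soon as all [v] outside [S :|: [set 1]] have equally many
    neighbours in [S], the neighbourhood of [1]. As [C] is a clique through [1],
    such a [v] lies outside [C], so exactly [a] of its neighbours in [S] lie in
    [C]: the number of neighbours in [S] exceeds that in [S :\: C] by the
    constant [a]. *)

Import GroupScope.

Lemma mem_neighbours_cayley (gT : finGroupType) (S : {set gT}) (x y : gT) :
  (y \in neighbours (cayley S) x) = (x * y^-1 \in S).
Proof. by rewrite inE. Qed.

Lemma neighbours_cayley1 (gT : finGroupType) (S : {set gT}) :
  S = S^-1 -> neighbours (cayley S) 1 = S.
Proof. by move=> SV; apply/setP=> y; rewrite inE /cayley mul1g -mem_invg -SV. Qed.

Lemma neighbours_cayleyM (gT : finGroupType) (S : {set gT}) (x g : gT) :
  neighbours (cayley S) (x * g) = neighbours (cayley S) x :* g.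
Proof.
by apply/setP=> z; rewrite mem_rcoset !mem_neighbours_cayley invMg invgK mulgA.
Qed.

(** Right translation by [x^-1] carries the pair [x], [y] to [1], [y * x^-1], and the neighbourhood
    of [1] is [S]. *)
Lemma card_common_neighbours_cayley (gT : finGroupType) (S : {set gT})
    (x y : gT) : S = S^-1 ->
  #|neighbours (cayley S) x :&: neighbours (cayley S) y| =
  #|neighbours (cayley S) (y * x^-1) :&: S|.
Proof.
move=> SV; rewrite -{1}[x]mul1g -{1}[y](mulgKV x) !neighbours_cayleyM.
rewrite (neighbours_cayley1 _ _ SV) setIC -[RHS](card_rcoset _ x).
by congr #|pred_of_set _|; apply/setP=> z; rewrite !(inE, mem_rcoset).
Qed.

Lemma card_neighbours_connection_set (gT : finGroupType) (S C : {set gT})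
    (a : nat) (v : gT) :
  S = S^-1 -> regular_clique (cayley S) C a -> 1 \in C ->
  v \in ~: (S :|: [set 1]) ->
  #|neighbours (cayley S) v :&: S| =
  (a + #|neighbours (cayley S) v :&: (S :\: C)|)%N.
Proof.
move=> SV [Cclique _ Cnexus] C1; rewrite !inE negb_or => /andP[vS v1].
have CS x : x \in C -> x != 1 -> x \in S.
  by move=> Cx x1; have:= Cclique x 1 Cx C1 x1; rewrite /cayley invg1 mulg1.
have vC : v \notin C by apply: contra vS => Cv; apply: CS.
rewrite -(Cnexus v vC) -(cardsID C) setIDA; congr (_ + _)%N.
apply: eq_card => x; rewrite !inE /cayley -andbA.
case Cx: (x \in C); rewrite !(andbT, andbF) //.
(* Only [1] can lie in [C] but not in [S], and it is no neighbour of [v] because [v] is not in [S];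
   so [v] has the same neighbours in [C] as in the part of [C] inside [S]. *)
have [->|x1] := eqVneq x 1; first by rewrite invg1 mulg1 (negbTE vS).
by rewrite CS ?andbT.
Qed.

Theorem theorem3p1 (gT : finGroupType) (S C : {set gT}) (n k lambda a c : nat)
    (hS1 : S \subset [set~ 1%g]) (hSV : S = (S^-1)%g)
    (hN : neumaier (cayley S) n k lambda a c)
    (hC : regular_clique (cayley S) C a) (hCc : #|C| = c) (hC1 : 1%g \in C) :
  strongly_regular (cayley S) <->
  (forall v w : gT, v \in ~: (S :|: [set 1%g]) -> w \in ~: (S :|: [set 1%g]) ->
     #|neighbours (cayley S) v :&: (S :\: C)| =
     #|neighbours (cayley S) w :&: (S :\: C)|).
Proof.
have cardS v := card_neighbours_connection_set _ S C a v hSV hC hC1.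
split=> [[n' [k' [l' [mu [_ srg]]]]] v w hv hw | hvw].
  have muE u : u \in ~: (S :|: [set 1]) -> #|neighbours (cayley S) u :&: S| = mu.
    rewrite !inE negb_or => /andP[uS u1].
    (* Read as the neighbourhood of [1], the second [S] turns the count into the common neighbours
       of the non-adjacent pair [u], [1]. *)
    by rewrite -{2}(neighbours_cayley1 _ _ hSV) srg // /cayley invg1 mulg1.
  by apply: (@addnI a); rewrite -!cardS // !muE.
have [hE _ _] := hN; exists n, k, lambda.
have nonadj x y : x != y -> ~~ cayley S x y -> y * x^-1 \in ~: (S :|: [set 1]).
  (* [y * x^-1] is the inverse of [x * y^-1], and [S] is closed under inverses. *)
  move=> xy xyS; rewrite !inE negb_or -eq_mulgV1 eq_sym xy andbT.
  by rewrite hSV mem_invg invMg invgK.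
(* The value [mu] is read off at any [u] outside [S :|: [set 1]]. If there were none, no two
   distinct vertices would be non-adjacent and [0] would do vacuously. *)
have [u hu|no_u] := pickP [in ~: (S :|: [set 1])]; last first.
  by exists 0; split=> // x y xy /(nonadj x y xy); rewrite [_ \in _]no_u.
exists #|neighbours (cayley S) u :&: S|; split=> // x y xy /(nonadj x y xy) hxy.
by rewrite card_common_neighbours_cayley // !cardS // (hvw _ u).
Qed.
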